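(* Let $\triangle PQR$ be a triangle contained in $D$. Then there exists a triangle $\triangle P'Q'R'\subset D$ that is (Euclidean-)similar to $\triangle PQR$ such that for every triangle $\triangle ABC\subset D$ that is (Euclidean-)congruent to $\triangle P'Q'R'$, $\rho(\psi_{\triangle ABC})=\frac13$.
   Context: $D$ is the open unit disk in $\mathbb{R}^2$ and $S^1$ its boundary, identified with $\mathbb{R}/\mathbb{Z}$ via $t\mapsto(\cos2\pi t,\sin2\pi t)$. Triangles are non-degenerate closed Euclidean triangles. For a triangle $T\subset D$ and $v\in S^1$, there are exactly two chords $vv_1,vv_2$ of $S^1$ whose lines support $T$; with $v_1$ the one reached first moving counterclockwise from $v$, set $\psi_T(v):=v_1$ (a homeomorphism of $S^1$). $\rho(\psi_T)=\lim_{n\to\infty}\overline{\psi_T}^{\,n}(0)/n$ is its rotation number, where $\overline{\psi_T}$ is the lift to $\mathbb{R}$ with $\overline{\psi_T}(0)\in(0,1)$. *)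

(* Defs.v *)
From Stdlib Require Import Reals Lra ClassicalEpsilon.
From Coquelicot Require Import Coquelicot.
Open Scope R_scope.

Definition point := (R * R)%type.

Definition dist2 (x y : point) : R :=
  sqrt ((fst x - fst y) ^ 2 + (snd x - snd y) ^ 2).

Definition in_D (x : point) : Prop := (fst x) ^ 2 + (snd x) ^ 2 < 1.

Definition cross (o a b : point) : R :=
  (fst a - fst o) * (snd b - snd o) - (snd a - snd o) * (fst b - fst o).
Definition nondegenerate (A B C : point) : Prop := cross A B C <> 0.

Definition closed_triangle (A B C : point) : point -> Prop :=
  fun x => exists a b c : R, 0 <= a /\ 0 <= b /\ 0 <= c /\ a + b + c = 1 /\
    fst x = a * fst A + b * fst B + c * fst C /\
    snd x = a * snd A + b * snd B + c * snd C.

Definition subset_D (T : point -> Prop) : Prop := forall x, T x -> in_D x.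

Definition image (f : point -> point) (T : point -> Prop) : point -> Prop :=
  fun y => exists x, T x /\ y = f x.

Definition similarity (f : point -> point) : Prop :=
  exists k : R, 0 < k /\ forall x y, dist2 (f x) (f y) = k * dist2 x y.
Definition isometry (f : point -> point) : Prop :=
  forall x y, dist2 (f x) (f y) = dist2 x y.

Definition similar (T1 T2 : point -> Prop) : Prop :=
  exists f, similarity f /\ (forall y, image f T1 y <-> T2 y).
Definition congruent (T1 T2 : point -> Prop) : Prop :=
  exists f, isometry f /\ (forall y, image f T1 y <-> T2 y).

(** S^1 = R/Z, parametrised by t |-> (cos 2 pi t, sin 2 pi t). *)
Definition pt (t : R) : point := (cos (2 * PI * t), sin (2 * PI * t)).

Definition supports (T : point -> Prop) (p q : point) : Prop :=
  (exists x, T x /\ cross p q x = 0) /\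
  ((forall x, T x -> 0 <= cross p q x) \/ (forall x, T x -> cross p q x <= 0)).

(** [psi_disp T t s]: s in (0,1) is the counterclockwise displacement from t
    to psi_T(t), i.e. the chord from pt t to pt (t+s) supports T and it is the
    first such chord endpoint reached moving counterclockwise from pt t. *)
Definition psi_disp (T : point -> Prop) (t s : R) : Prop :=
  0 < s < 1 /\ supports T (pt t) (pt (t + s)) /\
  (forall s', 0 < s' < s -> ~ supports T (pt t) (pt (t + s'))).

(** The lift of psi_T to R with value at 0 in (0,1): t |-> t + s(t). *)
Definition psi_lift (T : point -> Prop) (t : R) : R :=
  t + epsilon (inhabits 0) (fun s => psi_disp T t s).

Definition rotation_number_is (T : point -> Prop) (r : R) : Prop :=
  is_lim_seq (fun n : nat => Nat.iter n (psi_lift T) 0 / INR n) r.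

(* Main.v *)
(** For a point [V] of the disk let [F_V] be (the lift of) the map sending [v] to the
    other end of the chord through [v] and [V].  Each [F_V] is increasing, [F_V o F_V] is
    a full turn, and [psi_T] is the minimum of [F_A], [F_B], [F_C].

    Starting at an end of the line [AB], this alone forces three steps of [psi_T] to make
    at least one full turn, so the rotation number of any triangle is at least 1/3.

    For the converse it suffices to inscribe in the circle a triangle [xyz] each of whose
    sides has a point of [T] on it or beyond it.  This is possible as soon as two vertices
    [A], [B] are close enough to the circle: take [x] on the outer side of [AB] and let
    [y], [z] be the far ends of the chords from [x] through [B] and [A].

    Two vertices are close to the circle in every position of [T] inside the disk when the
    smallest disk enclosing [T] has radius almost 1: its center is a convex combination of
    the points of [T] on its boundary, and by Lagrange's identity the weighted mean of
    the squared norms of these points is at least the squared radius. *)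

Require Import Defs.
From Stdlib Require Import ZArith Reals Lra Lia ClassicalEpsilon.
From Coquelicot Require Import Coquelicot.
Open Scope R_scope.

(** * The chord form and the reflection of the circle in a point *)

(* The sign of [chord_form V t u] tells on which side of the chord from [pt t] to [pt u]
   the point [V] lies (see [cross_pt]).  In the vectors [(cos (PI t), sin (PI t))] and
   [(cos (PI u), sin (PI u))] it is a symmetric bilinear form of determinant [1 - |V|^2],
   hence an inner product when [V] is in the disk: [F_V] is a quarter turn for it. *)
Definition chord_form (V : point) (t u : R) : R :=
  (1 - fst V) * (cos (PI * t) * cos (PI * u))
  + (1 + fst V) * (sin (PI * t) * sin (PI * u))
  - snd V * (sin (PI * t) * cos (PI * u) + cos (PI * t) * sin (PI * u)).

Lemma sin_PI_sub t u :
  sin (PI * (u - t)) = sin (PI * u) * cos (PI * t) - cos (PI * u) * sin (PI * t).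
Proof. rewrite Rmult_minus_distr_l. apply sin_minus. Qed.

Lemma cos_sqr_1_minus x : cos x * cos x = 1 - sin x * sin x.
Proof. pose proof (sin2_cos2 x) as H; unfold Rsqr in H; lra. Qed.

(** The determinant is quadratic in each half-angle vector and vanishes when [pt t] and [pt u]
    coincide, so a sine splits off. *)
Lemma cross_pt V t u :
  cross (pt t) (pt u) V = 2 * sin (PI * (u - t)) * chord_form V t u.
Proof.
  unfold cross, pt, chord_form; simpl.
  rewrite sin_PI_sub, !Rmult_assoc, !cos_2a, !sin_2a.
  pose proof (cos_sqr_1_minus (PI * t)) as Ht.
  pose proof (cos_sqr_1_minus (PI * u)) as Hu.
  set (c := cos (PI * t)) in *; set (s := sin (PI * t)) in *.
  set (c' := cos (PI * u)) in *; set (s' := sin (PI * u)) in *.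
  destruct V as [v w]; simpl.
  transitivity (2 * (s' * c - c' * s) * (c * c' + s * s')
    + w * (c' * c' - s' * s' - (c * c - s * s)) - v * (2 * s' * c' - 2 * s * c)).
  { ring. }
  replace (2 * s' * c' - 2 * s * c) with
    (2 * (s' * c - c' * s) * (c * c' - s * s')
     + 2 * s' * c' * (1 - s * s - c * c) - 2 * s * c * (1 - s' * s' - c' * c')) by ring.
  rewrite Ht, Hu.
  replace (1 - s' * s' - s' * s' - (1 - s * s - s * s)) with
    (- 2 * (s' * c - c' * s) * (s * c' + c * s')
     + 2 * (s' * s') * (c * c - (1 - s * s)) - 2 * (s * s) * (c' * c' - (1 - s' * s'))) by ring.
  rewrite Ht, Hu. ring.
Qed.

Lemma chord_form_sym V t u : chord_form V t u = chord_form V u t.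
Proof. unfold chord_form; ring. Qed.

(** The value is [1] minus the inner product of [V] with [pt t]. *)
Lemma chord_form_pos V t : in_D V -> 0 < chord_form V t t.
Proof.
  unfold in_D, chord_form; intros HV.
  pose proof (cos_sqr_1_minus (PI * t)) as H.
  set (c := cos (PI * t)) in *; set (s := sin (PI * t)) in *.
  destruct V as [v w]; simpl in *.
  assert (E : (c * c - s * s) * (c * c - s * s) + (2 * s * c) * (2 * s * c) = 1).
  { transitivity ((c * c + s * s) * (c * c + s * s)); [ring | rewrite H; ring]. }
  pose proof (Rle_0_sqr (v - (c * c - s * s))) as H1.
  pose proof (Rle_0_sqr (w - 2 * s * c)) as H2.
  unfold Rsqr in *. nra.
Qed.

Lemma chord_form_succ V t u : chord_form V t (u + 1) = - chord_form V t u.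
Proof.
  unfold chord_form.
  rewrite Rmult_plus_distr_l, Rmult_1_r, neg_sin, neg_cos. ring.
Qed.

(** The half-angle vectors of [u], [v], [w] lie in a plane; the sines are the coefficients of their
    linear relation. *)
Lemma chord_form_interp V t u v w :
  chord_form V t u * sin (PI * (w - v)) =
  chord_form V t v * sin (PI * (w - u)) + chord_form V t w * sin (PI * (u - v)).
Proof. rewrite !sin_PI_sub. unfold chord_form. ring. Qed.

Lemma sin_PI_mul_pos s : 0 < s < 1 -> 0 < sin (PI * s).
Proof. intros H. pose proof PI_RGT_0. apply sin_gt_0; nra. Qed.

Lemma chord_form_root V t :
  in_D V -> exists u, t < u < t + 1 /\ chord_form V t u = 0.
Proof.
  intros HV.
  pose proof (chord_form_pos V t HV) as Hp.
  destruct (IVT (fun u => - chord_form V t u) t (t + 1)) as [u [Hu Hz]].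
  - unfold chord_form. intros x. reg.
  - lra.
  - lra.
  - rewrite chord_form_succ. lra.
  - assert (Hz' : chord_form V t u = 0) by lra.
    exists u; split; [|exact Hz'].
    split; apply Rnot_le_lt; intros Hle.
    + replace u with t in Hz' by lra. lra.
    + replace u with (t + 1) in Hz' by lra. rewrite chord_form_succ in Hz'. lra.
Qed.

(* The lift [F_V]. *)
Definition hit (V : point) (t : R) : R :=
  epsilon (inhabits 0) (fun u => t < u < t + 1 /\ chord_form V t u = 0).

Section Hit.
Variables (V : point) (HV : in_D V).

Lemma hit_spec t : t < hit V t < t + 1 /\ chord_form V t (hit V t) = 0.
Proof. apply (epsilon_spec _ _ (chord_form_root V t HV)). Qed.

(** The other two factors are positive, so the form has the sign of [sin (PI * (hit V t - u))]:
    within a turn from [t] it changes sign only at the hit. *)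
Lemma chord_form_hit t u :
  chord_form V t u * sin (PI * (hit V t - t)) =
  chord_form V t t * sin (PI * (hit V t - u)).
Proof.
  rewrite (chord_form_interp V t u t (hit V t)), (proj2 (hit_spec t)). ring.
Qed.

Lemma chord_form_gt0 t u : t < u < t + 1 -> u < hit V t -> 0 < chord_form V t u.
Proof.
  intros Hu Hlt. pose proof (chord_form_hit t u) as E.
  pose proof (hit_spec t) as [Hh _]. pose proof (chord_form_pos V t HV).
  assert (0 < sin (PI * (hit V t - t))) by (apply sin_PI_mul_pos; lra).
  assert (0 < sin (PI * (hit V t - u))) by (apply sin_PI_mul_pos; lra).
  nra.
Qed.

Lemma chord_form_lt0 t u : t < u < t + 1 -> hit V t < u -> chord_form V t u < 0.
Proof.
  intros Hu Hlt. pose proof (chord_form_hit t u) as E.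
  pose proof (hit_spec t) as [Hh _]. pose proof (chord_form_pos V t HV).
  assert (0 < sin (PI * (hit V t - t))) by (apply sin_PI_mul_pos; lra).
  assert (0 < sin (PI * (u - hit V t))) by (apply sin_PI_mul_pos; lra).
  replace (PI * (hit V t - u)) with (- (PI * (u - hit V t))) in E by ring.
  rewrite sin_neg in E. nra.
Qed.

Lemma hit_unique t u : t < u < t + 1 -> chord_form V t u = 0 -> u = hit V t.
Proof.
  intros Hu Hz.
  destruct (Rtotal_order u (hit V t)) as [H | [H | H]]; auto.
  - pose proof (chord_form_gt0 t u Hu H); lra.
  - pose proof (chord_form_lt0 t u Hu H); lra.
Qed.

Lemma hit_ge t u : t < u < t + 1 -> 0 <= chord_form V t u -> u <= hit V t.
Proof.
  intros Hu Hz. apply Rnot_lt_le; intros H.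
  pose proof (chord_form_lt0 t u Hu H); lra.
Qed.

(** By symmetry of the form the same chord leads back, one turn later in the lift. *)
Lemma hit_hit t : hit V (hit V t) = t + 1.
Proof.
  pose proof (hit_spec t) as [Hh Hz]. symmetry. apply hit_unique; [lra|].
  rewrite chord_form_succ, chord_form_sym, Hz. ring.
Qed.

(** [hit V] commutes with its own square, the shift by one. *)
Lemma hit_succ t : hit V (t + 1) = hit V t + 1.
Proof. rewrite <- hit_hit at 1. now rewrite hit_hit. Qed.

Lemma hit_mono t t' : t <= t' -> hit V t <= hit V t'.
Proof.
  intros [Hlt | ->]; [|lra].
  pose proof (hit_spec t) as [Hh Hz]. pose proof (hit_spec t') as [Hh' Hz'].
  apply Rnot_lt_le; intros Hc.
  assert (Hpos : 0 < chord_form V t (hit V t')) by (apply chord_form_gt0; lra).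
  (* From [hit V t'] the point [t + 1] comes before the hit [t' + 1]. *)
  assert (0 < chord_form V (hit V t') (t + 1)).
  { apply chord_form_gt0; [lra | rewrite hit_hit; lra]. }
  rewrite chord_form_succ, chord_form_sym in H. lra.
Qed.

End Hit.

(** * The map [psi_T] as a minimum over the vertices *)

Lemma cross_gt0_chord_form V t u :
  t < u < t + 1 -> (0 < cross (pt t) (pt u) V <-> 0 < chord_form V t u).
Proof.
  intros H. rewrite cross_pt.
  assert (0 < sin (PI * (u - t))) by (apply sin_PI_mul_pos; lra).
  split; intros; nra.
Qed.

Lemma cross_combination p q A B C x a b c :
  a + b + c = 1 ->
  fst x = a * fst A + b * fst B + c * fst C ->
  snd x = a * snd A + b * snd B + c * snd C ->
  cross p q x = a * cross p q A + b * cross p q B + c * cross p q C.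
Proof.
  intros H H1 H2. unfold cross. rewrite H1, H2.
  replace c with (1 - a - b) by lra. ring.
Qed.

Lemma vertices_in_triangle A B C :
  closed_triangle A B C A /\ closed_triangle A B C B /\ closed_triangle A B C C.
Proof.
  repeat split; [exists 1, 0, 0 | exists 0, 1, 0 | exists 0, 0, 1]; repeat split; lra.
Qed.

Definition min3 (x y z : R) : R := Rmin x (Rmin y z).

Lemma min3_cases x y z :
  min3 x y z <= x /\ min3 x y z <= y /\ min3 x y z <= z /\
  (min3 x y z = x \/ min3 x y z = y \/ min3 x y z = z).
Proof.
  unfold min3, Rmin.
  destruct (Rle_dec y z); destruct (Rle_dec x _); repeat split; auto; lra.
Qed.

Section Triangle.
Variables (A B C : point).
Hypotheses (HA : in_D A) (HB : in_D B) (HC : in_D C).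

Let T := closed_triangle A B C.

(** No vertex is to the right of the chord to the first hit. For an earlier end all are strictly to
    the left, so the line misses the triangle. *)
Lemma psi_lift_min3 t : psi_lift T t = min3 (hit A t) (hit B t) (hit C t).
Proof.
  pose proof (hit_spec A HA t) as [HA1 HA2].
  pose proof (hit_spec B HB t) as [HB1 HB2].
  pose proof (hit_spec C HC t) as [HC1 HC2].
  pose proof (min3_cases (hit A t) (hit B t) (hit C t)) as (Ha & Hb & Hc & Hmin).
  set (m := min3 _ _ _) in *.
  assert (Hm : psi_disp T t (m - t)).
  { unfold psi_disp. split; [destruct Hmin as [E | [E | E]]; lra|]. split.
    - replace (t + (m - t)) with m by ring.
      assert (Hr : t < m < t + 1) by (destruct Hmin as [E | [E | E]]; lra).
      assert (Hs : 0 < sin (PI * (m - t))) by (apply sin_PI_mul_pos; lra).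
      destruct (vertices_in_triangle A B C) as (TA & TB & TC).
      split.
      + destruct Hmin as [E | [E | E]]; [exists A | exists B | exists C];
          (split; [assumption|]); rewrite cross_pt, E;
          rewrite ?HA2, ?HB2, ?HC2; ring.
      + left. intros x (a & b & c & Ha0 & Hb0 & Hc0 & Hsum & H1 & H2).
        rewrite (cross_combination _ _ A B C x a b c Hsum H1 H2).
        assert (forall V, in_D V -> m <= hit V t -> 0 <= cross (pt t) (pt m) V).
        { intros V HV Hle. rewrite cross_pt. apply Rmult_le_pos; [lra|].
          destruct Hle as [Hl | ->].
          - left; apply chord_form_gt0; auto.
          - right; symmetry; apply hit_spec; auto. }
        pose proof (H A HA Ha). pose proof (H B HB Hb). pose proof (H C HC Hc). nra.
    - intros s' Hs' [[x [(a & b & c & Ha0 & Hb0 & Hc0 & Hsum & H1 & H2) Hx]] _].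
      rewrite (cross_combination _ _ A B C x a b c Hsum H1 H2) in Hx.
      assert (forall V, in_D V -> m <= hit V t -> 0 < cross (pt t) (pt (t + s')) V).
      { intros V HV Hle. pose proof (hit_spec V HV t).
        apply cross_gt0_chord_form; [lra|]. apply chord_form_gt0; auto; lra. }
      pose proof (H A HA Ha). pose proof (H B HB Hb). pose proof (H C HC Hc).
      destruct (Rlt_dec 0 a); [nra|]. destruct (Rlt_dec 0 b); nra. }
  unfold psi_lift.
  (* Of two different displacements the smaller would contradict the minimality of the larger, so
     [epsilon] returns [m - t]. *)
  assert (He : psi_disp T t (epsilon (inhabits 0) (fun s => psi_disp T t s))).
  { apply epsilon_spec. exists (m - t). exact Hm. }
  set (e := epsilon _ _) in *.
  destruct Hm as (Hm1 & Hm2 & Hm3). destruct He as (He1 & He2 & He3).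
  destruct (Rtotal_order e (m - t)) as [H | [H | H]]; [|lra|].
  - exfalso. apply (Hm3 e); auto; lra.
  - exfalso. apply (He3 (m - t)); auto; lra.
Qed.

Lemma psi_lift_bounds t : t < psi_lift T t < t + 1.
Proof.
  rewrite psi_lift_min3.
  pose proof (hit_spec A HA t). pose proof (hit_spec B HB t). pose proof (hit_spec C HC t).
  destruct (min3_cases (hit A t) (hit B t) (hit C t)) as (_ & _ & _ & [E | [E | E]]); lra.
Qed.

Lemma psi_lift_succ t : psi_lift T (t + 1) = psi_lift T t + 1.
Proof.
  rewrite !psi_lift_min3, !hit_succ by assumption.
  unfold min3. now rewrite !Rplus_min_distr_r.
Qed.

Lemma psi_lift_mono t t' : t <= t' -> psi_lift T t <= psi_lift T t'.
Proof.
  intros H. rewrite !psi_lift_min3.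
  pose proof (hit_mono A HA t t' H). pose proof (hit_mono B HB t t' H).
  pose proof (hit_mono C HC t t' H).
  destruct (min3_cases (hit A t) (hit B t) (hit C t)) as (? & ? & ? & _).
  destruct (min3_cases (hit A t') (hit B t') (hit C t')) as (_ & _ & _ & [E | [E | E]]); lra.
Qed.

(** If [u] came before all three hits, every point of [T] would lie strictly to the left of the
    chord. *)
Lemma psi_lift_le t u x :
  t < u < t + 1 -> T x -> cross (pt t) (pt u) x <= 0 -> psi_lift T t <= u.
Proof.
  intros Hu (a & b & c & Ha0 & Hb0 & Hc0 & Hsum & H1 & H2) Hx.
  rewrite (cross_combination _ _ A B C x a b c Hsum H1 H2) in Hx.
  rewrite psi_lift_min3. apply Rnot_lt_le; intros Hlt.
  destruct (min3_cases (hit A t) (hit B t) (hit C t)) as (Ha & Hb & Hc & _).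
  assert (forall V, in_D V -> u < hit V t -> 0 < cross (pt t) (pt u) V).
  { intros V HV Hle. apply cross_gt0_chord_form; auto. apply chord_form_gt0; auto. }
  pose proof (H A HA ltac:(lra)). pose proof (H B HB ltac:(lra)).
  pose proof (H C HC ltac:(lra)).
  destruct (Rlt_dec 0 a); [nra|]. destruct (Rlt_dec 0 b); nra.
Qed.

(* If the chord from [t] to [y] carries the side [AB], then the second chord cannot
   touch [A] or [B] without returning to [t + 1], and the third cannot touch [C] if the
   second did, since reflecting twice in a vertex is a full turn. *)
Lemma psi_lift_iter3_ge t :
  hit A t = hit B t -> hit A t <= hit C t -> t + 1 <= Nat.iter 3 (psi_lift T) t.
Proof.
  intros HAB HAC. simpl.
  assert (E1 : psi_lift T t = hit A t).
  { rewrite psi_lift_min3.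
    destruct (min3_cases (hit A t) (hit B t) (hit C t)) as (? & ? & ? & [E | [E | E]]); lra. }
  rewrite E1. set (y := hit A t).
  pose proof (psi_lift_bounds y) as Hz. set (z := psi_lift T y) in *.
  pose proof (psi_lift_bounds z) as Hw.
  assert (HAy : hit A y = t + 1) by (apply hit_hit; assumption).
  assert (HBy : hit B y = t + 1) by (unfold y; rewrite HAB; apply hit_hit; assumption).
  assert (t < y) by (apply hit_spec; assumption).
  destruct (min3_cases (hit A y) (hit B y) (hit C y)) as (_ & _ & _ & E2).
  rewrite <- psi_lift_min3 in E2. fold z in E2.
  destruct E2 as [E2 | [E2 | E2]]; [lra | lra |].
  destruct (min3_cases (hit A z) (hit B z) (hit C z)) as (_ & _ & _ & E3).
  rewrite <- psi_lift_min3 in E3.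
  destruct E3 as [E3 | [E3 | E3]]; rewrite E3.
  - rewrite <- HAy. apply hit_mono; [assumption | lra].
  - rewrite <- HBy. apply hit_mono; [assumption | lra].
  - rewrite E2, hit_hit by assumption. lra.
Qed.

End Triangle.

(** * Rotation number from bounds on a third iterate *)

Lemma nat_ind_step3 (P : nat -> Prop) :
  P 0%nat -> P 1%nat -> P 2%nat -> (forall n, P n -> P (n + 3)%nat) -> forall n, P n.
Proof.
  intros H0 H1 H2 Hstep n.
  enough (P n /\ P (S n) /\ P (S (S n))) by tauto.
  induction n as [|n (I0 & I1 & I2)]; [auto|].
  repeat split; auto. replace (S (S (S n))) with (n + 3)%nat by lia. auto.
Qed.

Section RotationNumber.
Variable (F : R -> R).
Hypotheses (F_succ : forall t, F (t + 1) = F t + 1)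
  (F_mono : forall t t', t <= t' -> F t <= F t')
  (F_bounds : forall t, t < F t < t + 1).

Lemma iter_add_nat n m t : Nat.iter n F (t + INR m) = Nat.iter n F t + INR m.
Proof.
  revert t. induction m as [|m IH]; intros t; [simpl; rewrite !Rplus_0_r; reflexivity|].
  rewrite S_INR, <- !Rplus_assoc.
  assert (E : forall x, Nat.iter n F (x + 1) = Nat.iter n F x + 1).
  { clear IH. induction n as [|n IHn]; intros x; simpl; [reflexivity|].
    rewrite IHn, F_succ. reflexivity. }
  rewrite E, IH. reflexivity.
Qed.

Lemma iter_mono n t t' : t <= t' -> Nat.iter n F t <= Nat.iter n F t'.
Proof. intros H; induction n; simpl; auto. Qed.

(** Each block of three steps gains a turn; the slack [1] covers the at most two remaining steps,
    which only move forward. *)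
Lemma iter_ge_third a :
  a + 1 <= Nat.iter 3 F a -> forall n, a + INR n / 3 - 1 <= Nat.iter n F a.
Proof.
  intros Ha. pose proof (F_bounds a). pose proof (F_bounds (F a)).
  apply nat_ind_step3; [simpl; lra | simpl; lra | simpl; lra |].
  intros m Hm. rewrite Nat.iter_add, plus_INR.
  apply Rle_trans with (Nat.iter m F (a + INR 1)).
  - rewrite iter_add_nat. simpl. lra.
  - apply iter_mono. simpl in *. lra.
Qed.

(** The slack [2] covers at most two remaining steps of less than a turn each. *)
Lemma iter_le_third b :
  Nat.iter 3 F b <= b + 1 -> forall n, Nat.iter n F b <= b + INR n / 3 + 2.
Proof.
  intros Hb. pose proof (F_bounds b). pose proof (F_bounds (F b)).
  apply nat_ind_step3; [simpl; lra | simpl; lra | simpl; lra |].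
  intros m Hm. rewrite Nat.iter_add, plus_INR.
  apply Rle_trans with (Nat.iter m F (b + INR 1)).
  - apply iter_mono. simpl in *. lra.
  - rewrite iter_add_nat. simpl. lra.
Qed.

Lemma rotation_number_third a b :
  a + 1 <= Nat.iter 3 F a -> Nat.iter 3 F b <= b + 1 ->
  is_lim_seq (fun n => Nat.iter n F 0 / INR n) (1 / 3).
Proof.
  intros Ha Hb.
  (* [m] turns carry [0] past [a] and [b] past [0], so up to the constant [m] the orbit of [0] lies
     between those of [a] and [b]. *)
  destruct (INR_unbounded (Rmax a (- b))) as [m Hm].
  pose proof (Rmax_l a (- b)). pose proof (Rmax_r a (- b)).
  assert (Hlim : forall K, is_lim_seq (fun n => 1 / 3 + K * / INR n) (1 / 3)).
  { intros K. replace (Finite (1 / 3)) with (Rbar_plus (1 / 3) (Rbar_mult K 0))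
      by (simpl; f_equal; ring).
    apply is_lim_seq_plus'; [apply is_lim_seq_const|].
    apply (is_lim_seq_scal_l (fun n => / INR n) K 0).
    apply (is_lim_seq_inv INR p_infty); [apply is_lim_seq_INR | discriminate]. }
  apply is_lim_seq_le_le_loc with
    (fun n => 1 / 3 + (a - 1 - INR m) * / INR n)
    (fun n => 1 / 3 + (b + 2 + INR m) * / INR n); [|apply Hlim | apply Hlim].
  exists 1%nat. intros n Hn.
  assert (0 < INR n) by (apply lt_0_INR; lia).
  assert (0 < / INR n) by (apply Rinv_0_lt_compat; assumption).
  assert (E : / INR n * INR n = 1) by (apply Rinv_l; lra).
  pose proof (iter_ge_third a Ha n) as La. pose proof (iter_le_third b Hb n) as Lb.
  pose proof (iter_mono n a (0 + INR m) ltac:(lra)) as Ma.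
  pose proof (iter_mono n 0 (b + INR m) ltac:(lra)) as Mb.
  rewrite iter_add_nat in Ma, Mb.
  set (x := Nat.iter n F 0) in *.
  replace (1 / 3) with (/ INR n * (INR n / 3)) by (field; lra).
  unfold Rdiv at 3. split; nra.
Qed.

End RotationNumber.

(** * Points of the circle and the line through two vertices *)

Lemma pt_surj p : fst p ^ 2 + snd p ^ 2 = 1 -> exists t, pt t = p.
Proof.
  destruct p as [x y]; simpl; intros H.
  assert (Hx : -1 <= x <= 1) by nra.
  pose proof PI_RGT_0 as HPI.
  assert (Hs : sin (acos x) = sqrt (y * y)).
  { rewrite sin_acos by assumption. f_equal. unfold Rsqr. lra. }
  destruct (Rle_dec 0 y) as [Hy | Hy].
  - exists (acos x / (2 * PI)). unfold pt.
    replace (2 * PI * (acos x / (2 * PI))) with (acos x) by (field; lra).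
    rewrite cos_acos, Hs, sqrt_square by assumption. reflexivity.
  - exists (- acos x / (2 * PI)). unfold pt.
    replace (2 * PI * (- acos x / (2 * PI))) with (- acos x) by (field; lra).
    rewrite cos_neg, sin_neg, cos_acos, Hs by assumption.
    replace (y * y) with (- y * - y) by ring.
    rewrite sqrt_square by lra. f_equal. ring.
Qed.

Lemma pt_succ t : pt (t + 1) = pt t.
Proof.
  unfold pt. replace (2 * PI * (t + 1)) with (2 * PI * t + 2 * PI) by ring.
  now rewrite cos_plus, sin_plus, cos_2PI, sin_2PI, !Rmult_1_r, !Rmult_0_r,
    Rminus_0_r, Rplus_0_r.
Qed.

Lemma pt_add_IZR t k : pt (t + IZR k) = pt t.
Proof.
  assert (N : forall n x, pt (x + INR n) = pt x).
  { induction n; intros x; [simpl; now rewrite Rplus_0_r|].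
    rewrite S_INR, <- Rplus_assoc, pt_succ. apply IHn. }
  destruct (Z_le_gt_dec 0 k) as [Hk | Hk].
  - rewrite <- (Z2Nat.id k Hk), <- INR_IZR_INZ. apply N.
  - rewrite <- (N (Z.to_nat (- k)) (t + IZR k)). f_equal.
    rewrite INR_IZR_INZ, Z2Nat.id, opp_IZR by lia. ring.
Qed.

Lemma pt_surj_from t p :
  fst p ^ 2 + snd p ^ 2 = 1 -> p <> pt t -> exists s, 0 < s < 1 /\ pt (t + s) = p.
Proof.
  intros Hp Hne. destruct (pt_surj p Hp) as [u Hu].
  destruct (archimed (u - t)) as [H1 H2].
  (* The fractional part of [u - t]; it is not [0] because [p <> pt t]. *)
  exists (u - t - (IZR (up (u - t)) - 1)).
  assert (E : pt (t + (u - t - (IZR (up (u - t)) - 1))) = p).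
  { rewrite <- Hu, <- (pt_add_IZR u (1 - up (u - t))), minus_IZR. f_equal. ring. }
  split; [|exact E].
  split; [|lra].
  destruct (Rle_lt_or_eq_dec 0 (u - t - (IZR (up (u - t)) - 1))) as [|E0]; [lra | assumption |].
  exfalso; apply Hne. rewrite <- E, <- E0, Rplus_0_r. reflexivity.
Qed.

(** For a point on the circle the form has determinant [0] and splits into two sines. Orientation
    thereby becomes cyclic order. *)
Lemma cross_pt3 t u v :
  cross (pt t) (pt u) (pt v) =
  4 * sin (PI * (u - t)) * sin (PI * (v - u)) * sin (PI * (v - t)).
Proof.
  rewrite cross_pt, !sin_PI_sub. unfold chord_form, pt; simpl.
  rewrite !Rmult_assoc, cos_2a, sin_2a.
  pose proof (cos_sqr_1_minus (PI * v)) as Hv.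
  set (c := cos (PI * v)) in *; set (s := sin (PI * v)) in *.
  replace (1 - (c * c - s * s)) with (2 * (s * s)) by lra.
  replace (1 + (c * c - s * s)) with (2 * (c * c)) by lra.
  ring.
Qed.

Lemma line_exit A u :
  in_D A -> 0 < fst u ^ 2 + snd u ^ 2 ->
  exists l, 0 < l /\ (fst A + l * fst u) ^ 2 + (snd A + l * snd u) ^ 2 = 1.
Proof.
  destruct A as [a b]; destruct u as [u v]; unfold in_D; simpl; intros HA Hu.
  set (d := u * (u * 1) + v * (v * 1)) in *.
  set (p := a * u + b * v).
  set (e := 1 - (a * (a * 1) + b * (b * 1))).
  assert (He : 0 < e) by (unfold e; lra).
  assert (Hde : 0 < d * e) by (apply Rmult_lt_0_compat; lra).
  (* The witness is the positive root of [d * l ^ 2 + 2 * p * l - e = 0]. *)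
  set (q := sqrt (p * p + d * e)).
  assert (Hq : q * q = p * p + d * e) by (apply sqrt_sqrt; nra).
  assert (Hq0 : 0 <= q) by apply sqrt_pos.
  assert (Hqp : 0 < q - p) by nra.
  exists ((q - p) / d). split; [apply Rdiv_lt_0_compat; lra|].
  transitivity (1 - e + 2 * ((q - p) / d) * p + ((q - p) / d) * ((q - p) / d) * d).
  { unfold e, p, d. ring. }
  transitivity (1 - e + (q * q - p * p) / d); [field; lra|].
  rewrite Hq. field. lra.
Qed.

Definition sqdist (x y : point) : R := (fst x - fst y) ^ 2 + (snd x - snd y) ^ 2.

Definition sqnorm (x : point) : R := fst x ^ 2 + snd x ^ 2.

Lemma cross_neq0_sqdist A B C : cross A B C <> 0 -> 0 < sqdist A B.
Proof.
  unfold cross, sqdist. intros H.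
  pose proof (pow2_ge_0 (fst A - fst B)). pose proof (pow2_ge_0 (snd A - snd B)).
  apply Rnot_le_lt; intros Hle. apply H.
  assert (E1 : (fst A - fst B) ^ 2 = 0) by lra.
  assert (E2 : (snd A - snd B) ^ 2 = 0) by lra.
  rewrite <- Rsqr_pow2 in E1, E2. apply Rsqr_0_uniq in E1, E2.
  replace (fst B) with (fst A) by lra. replace (snd B) with (snd A) by lra. ring.
Qed.

(* [pt t] is the end of the line [AB] on the side of [A]. *)
Lemma exists_common_hit A B C :
  in_D A -> in_D B -> in_D C -> 0 < cross A B C ->
  exists t, hit A t = hit B t /\ hit A t <= hit C t.
Proof.
  intros HA HB HC Hc.
  set (u := (fst B - fst A, snd B - snd A)).
  assert (Hu : 0 < fst u ^ 2 + snd u ^ 2).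
  { eapply Rlt_le_trans; [apply (cross_neq0_sqdist A B C); lra|].
    right. unfold sqdist, u; cbn [fst snd]; ring. }
  assert (Hu' : 0 < fst (- fst u, - snd u) ^ 2 + snd (- fst u, - snd u) ^ 2)
    by (eapply Rlt_le_trans; [exact Hu | right; cbn [fst snd]; ring]).
  destruct (line_exit A _ HA Hu') as (l & Hl & El).
  destruct (line_exit B _ HB Hu) as (m & Hm & Em).
  set (p := (fst A + l * - fst u, snd A + l * - snd u)).
  set (q := (fst B + m * fst u, snd B + m * snd u)).
  destruct (pt_surj p El) as [t Ht].
  (* [q - p] is [1 + l + m] times [B - A], so the chord has [A] and [B] on it and [C] to its
     left. *)
  assert (Hline : forall X, cross p q X = (1 + l + m) * cross A B X).
  { intros X. unfold p, q, u, cross; simpl. ring. }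
  assert (Hne : q <> pt t).
  { rewrite Ht. intros E. pose proof (Hline C) as H. rewrite E in H.
    assert (cross p p C = 0) by (unfold cross; ring). nra. }
  destruct (pt_surj_from t q Em Hne) as (s & Hs & Hq).
  assert (Hsin : 0 < sin (PI * (t + s - t))) by (apply sin_PI_mul_pos; lra).
  assert (Hform : forall X, 2 * sin (PI * (t + s - t)) * chord_form X t (t + s)
                            = (1 + l + m) * cross A B X).
  { intros X. rewrite <- Hline, <- Ht, <- Hq. symmetry; apply cross_pt. }
  assert (HhA : t + s = hit A t).
  { apply hit_unique; [assumption | lra |].
    pose proof (Hform A) as H. replace (cross A B A) with 0 in H by (unfold cross; ring).
    nra. }
  assert (HhB : t + s = hit B t).
  { apply hit_unique; [assumption | lra |].
    pose proof (Hform B) as H. replace (cross A B B) with 0 in H by (unfold cross; ring).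
    nra. }
  exists t. split; [congruence|]. rewrite <- HhA.
  apply hit_ge; [assumption | lra |].
  pose proof (Hform C). nra.
Qed.

(** * The inscribed triangle and the resulting rotation number *)

(** Power of a point: the distances from [V] to the two ends of a chord through it have product
    [1 - sqnorm V]. *)
Lemma second_intersection (x V : point) :
  sqnorm x = 1 -> in_D V ->
  let tau := (1 - sqnorm V) / sqdist V x in
  sqnorm (fst V + tau * (fst V - fst x), snd V + tau * (snd V - snd x)) = 1.
Proof.
  unfold in_D, sqnorm, sqdist. destruct x as [x y], V as [v w]; cbn [fst snd].
  intros Hx HV.
  assert (Hd : (v - x) ^ 2 + (w - y) ^ 2 <> 0).
  { intros E.
    pose proof (pow2_ge_0 (v - x)). pose proof (pow2_ge_0 (w - y)).
    assert (E1 : (v - x) ^ 2 = 0) by lra. assert (E2 : (w - y) ^ 2 = 0) by lra.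
    rewrite <- Rsqr_pow2 in E1, E2. apply Rsqr_0_uniq in E1, E2.
    replace v with x in HV by lra. replace w with y in HV by lra. lra. }
  set (d := (v - x) ^ 2 + (w - y) ^ 2) in *.
  set (e := 1 - (v ^ 2 + w ^ 2)).
  assert (Hp : 2 * (v * (v - x) + w * (w - y)) = d - e)
    by (unfold d, e; rewrite <- Hx; ring).
  transitivity (1 - e + e / d * (2 * (v * (v - x) + w * (w - y))) + e / d * (e / d) * d).
  { unfold e, d. ring. }
  rewrite Hp. field. exact Hd.
Qed.

Lemma cross_bound p q x :
  sqnorm p <= 1 -> sqnorm q <= 1 -> sqnorm x <= 1 -> Rabs (cross p q x) <= 8.
Proof.
  unfold sqnorm, cross. destruct p as [a b], q as [c d], x as [e f]; cbn [fst snd].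
  intros. apply Rabs_le.
  assert (-1 <= a <= 1) by nra. assert (-1 <= b <= 1) by nra.
  assert (-1 <= c <= 1) by nra. assert (-1 <= d <= 1) by nra.
  assert (-1 <= e <= 1) by nra. assert (-1 <= f <= 1) by nra.
  assert (H8 : forall s t, -2 <= s <= 2 -> -2 <= t <= 2 -> -4 <= s * t <= 4) by (intros; nra).
  pose proof (H8 (c - a) (f - b) ltac:(lra) ltac:(lra)).
  pose proof (H8 (d - b) (e - a) ltac:(lra) ltac:(lra)). lra.
Qed.

(* [x] is the outer unit normal of [AB]; [y] and [z] are the far ends of the chords
   from [x] through [B] and [A].  As [A] and [B] are close to the circle, [y] and [z] are
   close to [B] and [A], so that [C] is still on the outer side of [yz]. *)
Lemma exists_crossed_inscribed A B C :
  in_D A -> in_D B -> in_D C -> 0 < cross A B C ->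
  1024 * (1 - sqnorm A) <= cross A B C * sqdist A B ^ 2 ->
  1024 * (1 - sqnorm B) <= cross A B C * sqdist A B ^ 2 ->
  exists x y z : point,
    sqnorm x = 1 /\ sqnorm y = 1 /\ sqnorm z = 1 /\ 0 < cross x y z /\
    cross x y B <= 0 /\ cross y z C <= 0 /\ cross z x A <= 0.
Proof.
  intros HA HB HC Hc EA EB.
  assert (Hd : 0 < sqdist A B) by (apply (cross_neq0_sqdist A B C); lra).
  set (d := sqdist A B) in *.
  set (l := sqrt d).
  assert (Hl : 0 < l) by (apply sqrt_lt_R0; assumption).
  assert (Hll : l * l = d) by (apply sqrt_sqrt; lra).
  set (x := ((snd B - snd A) / l, - (fst B - fst A) / l) : point).
  (* The component of the whole line [AB] along [x]; thus [1 - h] is the distance from [x] to this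
     line. *)
  set (h := (fst A * (snd B - snd A) - snd A * (fst B - fst A)) / l).
  assert (Hx : sqnorm x = 1).
  { unfold sqnorm, x; cbn [fst snd].
    transitivity (d / (l * l)); [unfold d, sqdist; field; lra | rewrite Hll; field; lra]. }
  (* The midpoint of [AB] has component [h] along [x], and the parallelogram law bounds its norm. *)
  assert (Hh : 4 * (h * h) <= 4 - d).
  { unfold in_D, sqnorm in *.
    assert (E : h * h * d = (fst A * (snd B - snd A) - snd A * (fst B - fst A)) ^ 2).
    { rewrite <- Hll. unfold h. field. lra. }
    pose proof (Rle_0_sqr (fst A * (fst B - fst A) + snd A * (snd B - snd A)
       + (fst B * (fst B - fst A) + snd B * (snd B - snd A)))) as S.
    unfold Rsqr in S.
    assert (d * d <= (2 * (fst A ^ 2 + snd A ^ 2 + (fst B ^ 2 + snd B ^ 2)) - 4 * (h * h)) * d).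
    { rewrite Rmult_minus_distr_r, (Rmult_assoc 4), E. unfold d, sqdist. nra. }
    assert (d <= 2 * (fst A ^ 2 + snd A ^ 2 + (fst B ^ 2 + snd B ^ 2)) - 4 * (h * h)) by nra.
    lra. }
  assert (Hh1 : d / 8 <= 1 - h) by nra.
  assert (Hdist : forall V, V = A \/ V = B -> (1 - h) ^ 2 <= sqdist V x).
  { intros V HV.
    (* [h] is the component of [V] along [x]: Cauchy-Schwarz *)
    assert (E : fst x * fst V + snd x * snd V = h).
    { unfold x, h; cbn [fst snd]. destruct HV as [-> | ->]; field; lra. }
    assert (E' : 1 - h = fst x * (fst x - fst V) + snd x * (snd x - snd V)).
    { rewrite <- E, <- Hx. unfold sqnorm. ring. }
    rewrite E'.
    apply Rle_trans with (sqnorm x * sqdist V x); [|rewrite Hx; lra].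
    unfold sqnorm, sqdist.
    pose proof (Rle_0_sqr (fst x * (snd x - snd V) - snd x * (fst x - fst V))) as S.
    unfold Rsqr in S. nra. }
  (* Here [1024 = 64 * 16]: the squared distance to [x] is at least [d ^ 2 / 64], and [16] makes
     each error term below at most half the main term. *)
  assert (Htau : forall V, V = A \/ V = B ->
     0 <= (1 - sqnorm V) / sqdist V x <= cross A B C / 16).
  { intros V HV. pose proof (Hdist V HV) as D.
    assert (D1 : d ^ 2 / 64 <= sqdist V x) by nra.
    assert (D2 : 0 < d ^ 2) by nra.
    assert (HVD : 0 <= 1 - sqnorm V)
      by (unfold in_D, sqnorm in *; destruct HV as [-> | ->]; lra).
    assert (HVE : 1024 * (1 - sqnorm V) <= cross A B C * d ^ 2)
      by (destruct HV as [-> | ->]; assumption).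
    split.
    - apply Rmult_le_pos; [assumption|]. left; apply Rinv_0_lt_compat; lra.
    - apply Rmult_le_reg_r with (sqdist V x); [lra|].
      unfold Rdiv at 1. rewrite Rmult_assoc, Rinv_l by lra. nra. }
  pose proof (Htau A (or_introl eq_refl)) as HsA.
  pose proof (Htau B (or_intror eq_refl)) as HsB.
  pose proof (second_intersection x B Hx HB) as Ey.
  pose proof (second_intersection x A Hx HA) as Ez.
  cbv zeta in Ey, Ez.
  set (tau := (1 - sqnorm B) / sqdist B x) in *.
  set (sig := (1 - sqnorm A) / sqdist A x) in *.
  set (y := (fst B + tau * (fst B - fst x), snd B + tau * (snd B - snd x)) : point) in *.
  set (z := (fst A + sig * (fst A - fst x), snd A + sig * (snd A - snd x)) : point) in *.
  exists x, y, z. clearbody tau sig.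
  assert (Hxyz : 0 < cross x y z).
  { replace (cross x y z) with ((1 + tau) * (1 + sig) * (- cross A B x))
      by (unfold y, z, cross; cbn [fst snd]; ring).
    replace (cross A B x) with (- (l * (1 - h))).
    2:{ unfold cross, h, x; cbn [fst snd].
        transitivity (- (l * l) / l + (fst A * (snd B - snd A) - snd A * (fst B - fst A)));
          [field; lra|]. rewrite Hll. unfold d, sqdist. field. lra. }
    rewrite Ropp_involutive.
    repeat apply Rmult_lt_0_compat; lra. }
  repeat split; auto.
  - right. unfold y, cross; cbn [fst snd]. ring.
  (* [cross] is affine in each argument; [y] and [z] are affine combinations of [B], [x] and of [A],
     [x]. *)
  - replace (cross y z C) with
      ((1 + tau) * (1 + sig) * (- cross A B C)
       - (1 + tau) * sig * cross B x C - tau * (1 + sig) * cross x A C)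
      by (unfold y, z, cross; cbn [fst snd]; ring).
    assert (NA : sqnorm A <= 1) by (unfold in_D, sqnorm in *; lra).
    assert (NB : sqnorm B <= 1) by (unfold in_D, sqnorm in *; lra).
    assert (NC : sqnorm C <= 1) by (unfold in_D, sqnorm in *; lra).
    pose proof (cross_bound B x C NB ltac:(lra) NC) as b1. apply Rabs_le_between in b1.
    pose proof (cross_bound x A C ltac:(lra) NA NC) as b2. apply Rabs_le_between in b2.
    assert (I1 : - ((1 + tau) * sig * cross B x C) <= (1 + tau) * sig * 8).
    { assert (0 <= (1 + tau) * sig) by (apply Rmult_le_pos; lra). nra. }
    assert (I2 : - (tau * (1 + sig) * cross x A C) <= tau * (1 + sig) * 8).
    { assert (0 <= tau * (1 + sig)) by (apply Rmult_le_pos; lra). nra. }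
    assert (I3 : (1 + tau) * sig <= (1 + tau) * (1 + sig) * (cross A B C / 16)).
    { rewrite Rmult_assoc. apply Rmult_le_compat_l; [lra|]. nra. }
    assert (I4 : tau * (1 + sig) <= (1 + tau) * (1 + sig) * (cross A B C / 16)).
    { rewrite (Rmult_comm tau), (Rmult_comm (1 + tau)), Rmult_assoc.
      apply Rmult_le_compat_l; [lra|]. nra. }
    lra.
  - right. unfold z, cross; cbn [fst snd]. ring.
Qed.

(** By [cross_pt3], the order [v <= u] would make the orientation nonpositive. *)
Lemma inscribed_params x y z :
  sqnorm x = 1 -> sqnorm y = 1 -> sqnorm z = 1 -> 0 < cross x y z ->
  exists t u v, pt t = x /\ pt u = y /\ pt v = z /\ t < u /\ u < v /\ v < t + 1.
Proof.
  intros Hx Hy Hz Hc.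
  destruct (pt_surj x Hx) as [t Ht].
  destruct (pt_surj_from t y Hy) as (s & Hs & Es).
  { rewrite Ht. intros ->. unfold cross in Hc; lra. }
  destruct (pt_surj_from t z Hz) as (s' & Hs' & Es').
  { rewrite Ht. intros ->. unfold cross in Hc; lra. }
  exists t, (t + s), (t + s'). repeat split; auto; try lra.
  rewrite <- Ht, <- Es, <- Es', cross_pt3 in Hc.
  apply Rnot_le_lt; intros Hle.
  assert (0 < sin (PI * (t + s - t))) by (apply sin_PI_mul_pos; lra).
  assert (0 < sin (PI * (t + s' - t))) by (apply sin_PI_mul_pos; lra).
  assert (0 <= sin (PI * (t + s - (t + s')))).
  { destruct Hle as [Hl | El]; [left; apply sin_PI_mul_pos; lra|].
    right. rewrite El, Rminus_diag, Rmult_0_r, sin_0. reflexivity. }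
  replace (PI * (t + s' - (t + s))) with (- (PI * (t + s - (t + s')))) in Hc by ring.
  rewrite sin_neg in Hc.
  assert (0 <= 4 * sin (PI * (t + s - t)) * sin (PI * (t + s - (t + s'))) *
          sin (PI * (t + s' - t))) by (repeat apply Rmult_le_pos; lra).
  lra.
Qed.

(** [X], [Y], [Z] are arbitrary points of the triangle, so that preimages of vertices under a
    congruence can be used without identifying them as vertices. *)
Lemma rotation_number_third_of_points A B C X Y Z :
  nondegenerate A B C -> in_D A -> in_D B -> in_D C ->
  closed_triangle A B C X -> closed_triangle A B C Y -> closed_triangle A B C Z ->
  in_D X -> in_D Y -> in_D Z -> 0 < cross X Y Z ->
  1024 * (1 - sqnorm X) <= cross X Y Z * sqdist X Y ^ 2 ->
  1024 * (1 - sqnorm Y) <= cross X Y Z * sqdist X Y ^ 2 ->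
  rotation_number_is (closed_triangle A B C) (1 / 3).
Proof.
  intros Hnd HA HB HC TX TY TZ HX HY HZ Hc EX EY.
  assert (Hlow : exists a, a + 1 <= Nat.iter 3 (psi_lift (closed_triangle A B C)) a).
  { destruct (Rtotal_order (cross A B C) 0) as [H | [H | H]]; [| contradiction |].
    - destruct (exists_common_hit B A C) as (t & E & L); auto.
      { replace (cross B A C) with (- cross A B C) by (unfold cross; ring). lra. }
      exists t. apply psi_lift_iter3_ge; auto. lra.
    - destruct (exists_common_hit A B C) as (t & E & L); auto.
      exists t. apply psi_lift_iter3_ge; auto. }
  destruct Hlow as [a Ha].
  destruct (exists_crossed_inscribed X Y Z HX HY HZ Hc EX EY)
    as (x & y & z & Hx & Hy & Hz & Hxyz & C1 & C2 & C3).
  destruct (inscribed_params x y z Hx Hy Hz Hxyz) as (t & u & v & <- & <- & <- & L1 & L2 & L3).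
  (* The side from [z] to [x] becomes a chord from [v] to [t + 1]. The three sides bound the steps
     from [t], [u], [v] by [u], [v], [t + 1]. *)
  rewrite <- (pt_succ t) in C3.
  apply rotation_number_third with a t; auto.
  - intros; now apply psi_lift_succ.
  - intros; now apply psi_lift_mono.
  - intros; now apply psi_lift_bounds.
  - simpl.
    apply Rle_trans with (psi_lift (closed_triangle A B C) v);
      [|apply psi_lift_le with X; auto; lra].
    apply psi_lift_mono; auto.
    apply Rle_trans with (psi_lift (closed_triangle A B C) u);
      [|apply psi_lift_le with Z; auto; lra].
    apply psi_lift_mono; auto.
    apply psi_lift_le with Y; auto; lra.
Qed.

(** * Distance identities and scaling of the smallest enclosing disk *)

(** A Gram determinant, with the inner product written by polarization; it makes [cross] invariant
    up to sign under isometries. *)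
Lemma cross_sqr A B C :
  cross A B C ^ 2 =
  sqdist A B * sqdist A C - ((sqdist A B + sqdist A C - sqdist B C) / 2) ^ 2.
Proof. unfold cross, sqdist. field. Qed.

Lemma sqdist_of_dist2 X Y X' Y' : dist2 X Y = dist2 X' Y' -> sqdist X Y = sqdist X' Y'.
Proof.
  apply sqrt_inj; apply Rplus_le_le_0_compat; apply pow2_ge_0.
Qed.

Definition barycenter (A B C : point) (a b c : R) : point :=
  (a * fst A + b * fst B + c * fst C, a * snd A + b * snd B + c * snd C).

(** Lagrange's identity; the pair terms depend only on mutual distances. *)
Lemma sqnorm_weighted A B C a b c :
  a + b + c = 1 ->
  a * sqnorm A + b * sqnorm B + c * sqnorm C =
  sqnorm (barycenter A B C a b c)
  + (a * b * sqdist A B + a * c * sqdist A C + b * c * sqdist B C).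
Proof.
  intros H. replace c with (1 - a - b) by lra.
  unfold sqnorm, sqdist, barycenter; cbn [fst snd]. ring.
Qed.

(** The same identity with the origin moved to the barycenter. *)
Lemma sqdist_barycenter_weighted A B C a b c :
  a + b + c = 1 ->
  let O := barycenter A B C a b c in
  a * sqdist A O + b * sqdist B O + c * sqdist C O =
  a * b * sqdist A B + a * c * sqdist A C + b * c * sqdist B C.
Proof.
  intros H. replace c with (1 - a - b) by lra.
  unfold sqdist, barycenter; cbn [fst snd]. ring.
Qed.

Lemma closed_triangle_in_D A B C x :
  in_D A -> in_D B -> in_D C -> closed_triangle A B C x -> in_D x.
Proof.
  intros HA HB HC (a & b & c & Ha & Hb & Hc & Hs & E1 & E2).
  pose proof (sqnorm_weighted A B C a b c Hs) as E.
  assert (0 <= sqdist A B /\ 0 <= sqdist A C /\ 0 <= sqdist B C) as (D1 & D2 & D3).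
  { repeat split; apply Rplus_le_le_0_compat; apply pow2_ge_0. }
  assert (0 <= a * b * sqdist A B) by (repeat apply Rmult_le_pos; assumption).
  assert (0 <= a * c * sqdist A C) by (repeat apply Rmult_le_pos; assumption).
  assert (0 <= b * c * sqdist B C) by (repeat apply Rmult_le_pos; assumption).
  unfold in_D in *. rewrite E1, E2.
  unfold sqnorm, barycenter in E; cbn [fst snd] in E.
  set (nA := fst A ^ 2 + snd A ^ 2) in *. set (nB := fst B ^ 2 + snd B ^ 2) in *.
  set (nC := fst C ^ 2 + snd C ^ 2) in *.
  assert (a * nA + b * nB + c * nC < 1).
  { apply Rlt_le_trans with (a + b + c); [|lra].
    destruct (Rlt_dec 0 a); [nra|]. destruct (Rlt_dec 0 b); nra. }
  lra.
Qed.

(** As [k] increases to the inverse of the radius, the left side tends to [0] while [W * k ^ 6]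
    stays away from [0]. *)
Lemma exists_scale rho2 W :
  0 < rho2 -> 0 < W ->
  exists k, 0 < k /\ k ^ 2 * rho2 < 1 /\ 1 - k ^ 2 * rho2 <= W * k ^ 6.
Proof.
  intros Hr HW.
  set (rho := sqrt rho2).
  assert (Hrho : 0 < rho) by (apply sqrt_lt_R0; assumption).
  assert (Hrr : rho * rho = rho2) by (apply sqrt_sqrt; lra).
  (* A lower bound for the final [k], fixed in advance so that [M] can depend on it. *)
  set (k0 := / (2 * rho)).
  assert (Hk0 : 0 < k0) by (apply Rinv_0_lt_compat; lra).
  set (M := Rmin 1 (W * k0 ^ 6)).
  assert (HM : 0 < M).
  { apply Rmin_glb_lt; [lra|]. apply Rmult_lt_0_compat; [lra | apply pow_lt; lra]. }
  assert (HM1 : M <= 1) by apply Rmin_l.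
  assert (HM2 : M <= W * k0 ^ 6) by apply Rmin_r.
  exists ((1 - M / 2) / rho).
  assert (E : ((1 - M / 2) / rho) ^ 2 * rho2 = (1 - M / 2) ^ 2)
    by (rewrite <- Hrr; field; lra).
  rewrite E. repeat split.
  - apply Rdiv_lt_0_compat; lra.
  - nra.
  - apply Rle_trans with (W * k0 ^ 6); [nra|].
    apply Rmult_le_compat_l; [lra|]. apply pow_incr. split; [lra|].
    unfold k0. rewrite Rinv_mult. unfold Rdiv.
    apply Rmult_le_compat_r; [left; apply Rinv_0_lt_compat; lra | lra].
Qed.

(** A property of the set [T], so that the vertices can be permuted. *)
Definition robust_third (T : point -> Prop) : Prop :=
  exists P' Q' R' : point,
    nondegenerate P' Q' R' /\ subset_D (closed_triangle P' Q' R') /\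
    similar T (closed_triangle P' Q' R') /\
    forall A B C : point,
      nondegenerate A B C -> subset_D (closed_triangle A B C) ->
      congruent (closed_triangle A B C) (closed_triangle P' Q' R') ->
      rotation_number_is (closed_triangle A B C) (1 / 3).

Lemma robust_third_ext T T' :
  (forall x, T x <-> T' x) -> robust_third T -> robust_third T'.
Proof.
  intros H (P' & Q' & R' & Hn & Hs & (f & Hf & Hi) & Hall).
  exists P', Q', R'. repeat split; auto.
  exists f. split; [assumption|]. intros y. rewrite <- Hi.
  split; intros (x & Hx & ->); exists x; (split; [apply H; assumption | reflexivity]).
Qed.

Lemma closed_triangle_rotate A B C x : closed_triangle B C A x -> closed_triangle A B C x.
Proof.
  intros (a & b & c & ? & ? & ? & ? & E1 & E2).
  exists c, a, b. repeat split; auto; lra.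
Qed.

Lemma robust_third_rotate A B C :
  robust_third (closed_triangle A B C) -> robust_third (closed_triangle B C A).
Proof.
  apply robust_third_ext. intros x; split; intros H.
  - do 2 apply closed_triangle_rotate. exact H.
  - apply closed_triangle_rotate. exact H.
Qed.

Lemma similar_scaled P Q S O k :
  0 < k ->
  let f x := (k * (fst x - fst O), k * (snd x - snd O)) : point in
  similar (closed_triangle P Q S) (closed_triangle (f P) (f Q) (f S)).
Proof.
  intros Hk f. exists f. split.
  - exists k. split; [assumption|]. intros x y. unfold dist2, f; cbn [fst snd].
    rewrite <- (sqrt_pow2 k) at 5 by lra. rewrite <- sqrt_mult_alt by apply pow2_ge_0.
    f_equal. ring.
  - intros y. split.
    + intros (x & (a & b & c & ? & ? & ? & Hs & E1 & E2) & ->).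
      exists a, b, c. repeat split; auto; unfold f; cbn [fst snd];
        rewrite ?E1, ?E2; replace c with (1 - a - b) by lra; ring.
    + intros (a & b & c & ? & ? & ? & Hs & E1 & E2).
      exists (barycenter P Q S a b c). split.
      * exists a, b, c. repeat split; auto.
      * destruct y as [y1 y2]; unfold f, barycenter in *; cbn [fst snd] in *.
        rewrite E1, E2. replace c with (1 - a - b) by lra. f_equal; ring.
Qed.

(** [O] is the center of the smallest enclosing disk, with [P] and [Q] on its boundary. The factor
    [c] puts [S] there too unless its weight is [0]. *)
Lemma robust_third_of_weights P Q S a b c :
  nondegenerate P Q S -> 0 < a -> 0 < b -> 0 <= c -> a + b + c = 1 ->
  let O := barycenter P Q S a b c in
  sqdist Q O = sqdist P O -> sqdist S O <= sqdist P O ->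
  c * sqdist S O = c * sqdist P O ->
  robust_third (closed_triangle P Q S).
Proof.
  intros Hnd Ha Hb Hc Hsum O EQ LS ES.
  pose proof (cross_neq0_sqdist P Q S Hnd) as HD.
  set (rho2 := sqdist P O) in *.
  assert (Hrho : 0 < rho2).
  { assert (sqdist P Q <= 2 * (sqdist P O + sqdist Q O)); [|unfold rho2 in *; lra].
    unfold sqdist.
    pose proof (pow2_ge_0 (fst P - fst O + (fst Q - fst O))).
    pose proof (pow2_ge_0 (snd P - snd O + (snd Q - snd O))). nra. }
  pose proof (sqdist_barycenter_weighted P Q S a b c Hsum) as EV.
  cbv zeta in EV. fold O in EV.
  rewrite EQ, ES in EV. fold rho2 in EV.
  replace (a * rho2 + b * rho2 + c * rho2) with rho2 in EV
    by (rewrite <- (Rmult_1_l rho2) at 1; rewrite <- Hsum; ring).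
  assert (Hdelta : 0 < Rabs (cross P Q S)) by (apply Rabs_pos_lt; exact Hnd).
  set (D := sqdist P Q) in *. set (delta := Rabs (cross P Q S)) in *.
  (* Scaling by [k] multiplies [delta * D ^ 2] by [k ^ 6]; [Rmin a b] allows division by either
     weight. *)
  set (W := Rmin a b * (delta * D ^ 2 / 1024)).
  assert (HW0 : 0 < delta * D ^ 2 / 1024).
  { assert (0 < D ^ 2) by (apply pow_lt; lra). nra. }
  assert (HW : 0 < W).
  { apply Rmult_lt_0_compat; [apply Rmin_glb_lt; lra | assumption]. }
  destruct (exists_scale rho2 W Hrho HW) as (k & Hk & Hk1 & Hk2).
  set (f := fun x : point => (k * (fst x - fst O), k * (snd x - snd O)) : point).
  assert (Hfd : forall x y, sqdist (f x) (f y) = k ^ 2 * sqdist x y).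
  { intros x y. unfold f, sqdist; cbn [fst snd]. ring. }
  assert (HfD : forall x, sqdist x O <= rho2 -> in_D (f x)).
  { intros x Hx. unfold in_D.
    replace (fst (f x) ^ 2 + snd (f x) ^ 2) with (k ^ 2 * sqdist x O)
      by (unfold f, sqdist; cbn [fst snd]; ring).
    assert (0 < k ^ 2) by (apply pow_lt; assumption). nra. }
  exists (f P), (f Q), (f S). repeat split.
  - unfold nondegenerate.
    replace (cross (f P) (f Q) (f S)) with (k ^ 2 * cross P Q S)
      by (unfold f, cross; cbn [fst snd]; ring).
    apply Rmult_integral_contrapositive_currified; [apply pow_nonzero; lra | exact Hnd].
  - intros x. apply closed_triangle_in_D; apply HfD; unfold rho2 in *; lra.
  - apply (similar_scaled P Q S O k Hk).
  - intros A B C HABC Hsub (g & Hg & Himg).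
    destruct (vertices_in_triangle (f P) (f Q) (f S)) as (VP & VQ & VS).
    apply Himg in VP, VQ, VS.
    destruct VP as (X & TX & EX). destruct VQ as (Y & TY & EY). destruct VS as (Z & TZ & EZ).
    assert (DXY : sqdist X Y = k ^ 2 * D).
    { unfold D. rewrite <- Hfd, EX, EY. apply sqdist_of_dist2. symmetry; apply Hg. }
    assert (DXZ : sqdist X Z = k ^ 2 * sqdist P S).
    { rewrite <- Hfd, EX, EZ. apply sqdist_of_dist2. symmetry; apply Hg. }
    assert (DYZ : sqdist Y Z = k ^ 2 * sqdist Q S).
    { rewrite <- Hfd, EY, EZ. apply sqdist_of_dist2. symmetry; apply Hg. }
    (* The congruence may reverse orientation, hence the absolute value. *)
    assert (Hcross : Rabs (cross X Y Z) = k ^ 2 * delta).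
    { unfold delta. rewrite <- (Rabs_pos_eq (k ^ 2)) by apply pow2_ge_0.
      rewrite <- Rabs_mult. apply Rsqr_eq_abs_0. rewrite !Rsqr_pow2.
      rewrite cross_sqr, DXY, DXZ, DYZ, Rpow_mult_distr, cross_sqr. unfold D. field. }
    pose proof (Hsub X TX) as HX. pose proof (Hsub Y TY) as HY. pose proof (Hsub Z TZ) as HZ.
    (* By [EV] the pair terms equal [k ^ 2 * rho2] in every position. All three summands are
       nonnegative, so each is bounded separately. *)
    assert (Hnorm : a * (1 - sqnorm X) + b * (1 - sqnorm Y) + c * (1 - sqnorm Z)
                    <= 1 - k ^ 2 * rho2).
    { pose proof (sqnorm_weighted X Y Z a b c Hsum) as E.
      rewrite DXY, DXZ, DYZ in E. rewrite EV.
      assert (0 <= sqnorm (barycenter X Y Z a b c))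
        by (apply Rplus_le_le_0_compat; apply pow2_ge_0).
      lra. }
    change (sqnorm X < 1) in HX. change (sqnorm Y < 1) in HY. change (sqnorm Z < 1) in HZ.
    assert (Hw : forall w, W <= w * (delta * D ^ 2 / 1024) -> 0 < w -> forall n,
        w * (1 - n) <= 1 - k ^ 2 * rho2 ->
        1024 * (1 - n) <= Rabs (cross X Y Z) * sqdist X Y ^ 2).
    { intros w Hle Hw n Hn. rewrite Hcross, DXY.
      replace (k ^ 2 * delta * (k ^ 2 * D) ^ 2) with (1024 * (delta * D ^ 2 / 1024 * k ^ 6))
        by field.
      apply Rmult_le_compat_l; [lra|]. apply Rmult_le_reg_l with w; [assumption|].
      assert (0 < k ^ 6) by (apply pow_lt; assumption). nra. }
    assert (NX : 1024 * (1 - sqnorm X) <= Rabs (cross X Y Z) * sqdist X Y ^ 2).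
    { apply (Hw a); auto.
      - apply Rmult_le_compat_r; [lra | apply Rmin_l].
      - nra. }
    assert (NY : 1024 * (1 - sqnorm Y) <= Rabs (cross X Y Z) * sqdist X Y ^ 2).
    { apply (Hw b); auto.
      - apply Rmult_le_compat_r; [lra | apply Rmin_r].
      - nra. }
    assert (Hpos : 0 < Rabs (cross X Y Z)).
    { rewrite Hcross. apply Rmult_lt_0_compat; [apply pow_lt|]; assumption. }
    destruct (vertices_in_triangle A B C) as (TA & TB & TC).
    pose proof (Hsub A TA). pose proof (Hsub B TB). pose proof (Hsub C TC).
    (* Exchanging [X] and [Y] restores positive orientation. *)
    destruct (Rle_dec 0 (cross X Y Z)) as [Hs | Hs].
    + rewrite Rabs_pos_eq in NX, NY, Hpos by assumption.
      apply (rotation_number_third_of_points A B C X Y Z); auto.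
    + rewrite Rabs_left in NX, NY, Hpos by lra.
      replace (- cross X Y Z) with (cross Y X Z) in NX, NY, Hpos by (unfold cross; ring).
      replace (sqdist X Y) with (sqdist Y X) in NX, NY by (unfold sqdist; ring).
      apply (rotation_number_third_of_points A B C Y X Z); auto.
Qed.

(** * Obtuse and acute triangles *)

(* The inner product at the vertex [A], of the sign of the cosine of its angle. *)
Definition corner (A B C : point) : R :=
  (fst B - fst A) * (fst C - fst A) + (snd B - snd A) * (snd C - snd A).

(* The smallest enclosing disk has the side opposite the obtuse angle as diameter. *)
Lemma robust_third_obtuse P Q S :
  nondegenerate P Q S -> corner S P Q <= 0 -> robust_third (closed_triangle P Q S).
Proof.
  intros Hnd Hobt.
  apply (robust_third_of_weights P Q S (1 / 2) (1 / 2) 0); auto; try lra;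
    unfold sqdist, barycenter, corner in *; cbn [fst snd] in *; nra.
Qed.

(* The smallest enclosing disk is the circumscribed one. *)
Lemma robust_third_acute P Q S :
  nondegenerate P Q S -> 0 < corner P Q S -> 0 < corner Q S P -> 0 < corner S P Q ->
  robust_third (closed_triangle P Q S).
Proof.
  intros Hnd Hp Hq Hs.
  assert (EP : forall a b c, a + b + c = 1 -> sqdist P (barycenter P Q S a b c) =
    b ^ 2 * (corner P Q S + corner Q S P) + c ^ 2 * (corner P Q S + corner S P Q)
    + 2 * b * c * corner P Q S).
  { intros a b c H. replace a with (1 - b - c) by lra.
    unfold sqdist, barycenter, corner; cbn [fst snd]; ring. }
  assert (EQ : forall a b c, a + b + c = 1 -> sqdist Q (barycenter P Q S a b c) =
    a ^ 2 * (corner P Q S + corner Q S P) + c ^ 2 * (corner Q S P + corner S P Q)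
    + 2 * a * c * corner Q S P).
  { intros a b c H. replace b with (1 - a - c) by lra.
    unfold sqdist, barycenter, corner; cbn [fst snd]; ring. }
  assert (ES : forall a b c, a + b + c = 1 -> sqdist S (barycenter P Q S a b c) =
    a ^ 2 * (corner P Q S + corner S P Q) + b ^ 2 * (corner Q S P + corner S P Q)
    + 2 * a * b * corner S P Q).
  { intros a b c H. replace c with (1 - a - b) by lra.
    unfold sqdist, barycenter, corner; cbn [fst snd]; ring. }
  set (p := corner P Q S) in *. set (q := corner Q S P) in *. set (s := corner S P Q) in *.
  clearbody p q s.
  assert (HN : 0 < p * q + q * s + s * p).
  { pose proof (Rmult_lt_0_compat p q Hp Hq). pose proof (Rmult_lt_0_compat q s Hq Hs).
    pose proof (Rmult_lt_0_compat s p Hs Hp). lra. }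
  set (N := p * q + q * s + s * p) in *.
  (* The barycentric coordinates of the circumcenter: [q + s] is the squared side opposite [P], and
     [N] is the square of [cross P Q S]. *)
  set (a := p * (q + s) / (2 * N)). set (b := q * (p + s) / (2 * N)).
  set (c := s * (p + q) / (2 * N)).
  assert (Hsum : a + b + c = 1) by (unfold a, b, c, N in *; field; lra).
  assert (Ha : 0 < a) by (apply Rdiv_lt_0_compat; [apply Rmult_lt_0_compat|]; lra).
  assert (Hb : 0 < b) by (apply Rdiv_lt_0_compat; [apply Rmult_lt_0_compat|]; lra).
  assert (Hc : 0 < c) by (apply Rdiv_lt_0_compat; [apply Rmult_lt_0_compat|]; lra).
  assert (E1 : sqdist Q (barycenter P Q S a b c) = sqdist P (barycenter P Q S a b c)).
  { rewrite EP, EQ by assumption. unfold a, b, c, N in *. field. lra. }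
  assert (E2 : sqdist S (barycenter P Q S a b c) = sqdist P (barycenter P Q S a b c)).
  { rewrite EP, ES by assumption. unfold a, b, c, N in *. field. lra. }
  apply (robust_third_of_weights P Q S a b c); auto; try lra.
  rewrite E2. reflexivity.
Qed.

Theorem theorem5p1 (P Q R0 : point) :
  nondegenerate P Q R0 -> subset_D (closed_triangle P Q R0) ->
  exists P' Q' R' : point,
    nondegenerate P' Q' R' /\ subset_D (closed_triangle P' Q' R') /\
    similar (closed_triangle P Q R0) (closed_triangle P' Q' R') /\
    forall A B C : point,
      nondegenerate A B C -> subset_D (closed_triangle A B C) ->
      congruent (closed_triangle A B C) (closed_triangle P' Q' R') ->
      rotation_number_is (closed_triangle A B C) (1 / 3).
Proof.
  intros Hnd _.
  change (robust_third (closed_triangle P Q R0)).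
  assert (Hrot : forall A B C, nondegenerate A B C -> nondegenerate B C A).
  { unfold nondegenerate. intros A B C H.
    replace (cross B C A) with (cross A B C) by (unfold cross; ring). exact H. }
  (* A vertex whose angle is not acute is rotated into the last place. *)
  destruct (Rle_dec (corner R0 P Q) 0) as [H1 | H1]; [now apply robust_third_obtuse|].
  destruct (Rle_dec (corner P Q R0) 0) as [H2 | H2].
  { do 2 apply robust_third_rotate. apply robust_third_obtuse; auto. }
  destruct (Rle_dec (corner Q R0 P) 0) as [H3 | H3].
  { apply robust_third_rotate. apply robust_third_obtuse; auto. }
  apply robust_third_acute; auto; lra.
Qed.
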